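(* If $\Gamma;\Omega;\Delta\vdash M:A$ and $M\to_\beta M'$, then $\Gamma;\Omega;\Delta\vdash M':A$.
   Context: Strict $\lambda$-calculus over a signature $\Sigma$. Labels $k\in\{1,0,u\}$; types $A::=a\mid A_1\to^kA_2$; terms $c\mid x\mid\lambda x^k{:}A.M\mid M_1M_2^k$; $[N/x]M$ is capture-avoiding substitution. $\beta$-reduction: $(\lambda x^k{:}A.M)\,N^k\to_\beta[N/x]M$ (for each label $k$). Contexts: finite sets of declarations with distinct variables; commas denote disjoint union. Typing $\Gamma;\Omega;\Delta\vdash M:A$ (unrestricted, irrelevant, strict; disjoint): if $c{:}A\in\Sigma$ then $\Gamma;\Omega;\cdot\vdash c:A$; $(\Gamma,x{:}A);\Omega;\cdot\vdash x:A$; $\Gamma;\Omega;x{:}A\vdash x:A$ (no rule for $\Omega$); from $(\Gamma,x{:}A);\Omega;\Delta\vdash M:B$ infer $\Gamma;\Omega;\Delta\vdash\lambda x^u{:}A.M:A\to^uB$; from $\Gamma;(\Omega,x{:}A);\Delta\vdash M:B$ infer $\Gamma;\Omega;\Delta\vdash\lambda x^0{:}A.M:A\to^0B$; from $\Gamma;\Omega;(\Delta,x{:}A)\vdash M:B$ infer $\Gamma;\Omega;\Delta\vdash\lambda x^1{:}A.M:A\to^1B$; from $\Gamma;\Omega;\Delta\vdash M:A\to^uB$ and $(\Gamma,\Delta);\Omega;\cdot\vdash N:A$ infer $\Gamma;\Omega;\Delta\vdash MN^u:B$; from $\Gamma;\Omega;\Delta\vdash M:A\to^0B$ and $(\Gamma,\Omega,\Delta);\cdot;\cdot\vdash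 N:A$ infer $\Gamma;\Omega;\Delta\vdash MN^0:B$; from $(\Gamma,\Delta_N);\Omega;\Delta_M\vdash M:A\to^1B$ and $(\Gamma,\Delta_M);\Omega;\Delta_N\vdash N:A$ infer $\Gamma;\Omega;(\Delta_M,\Delta_N)\vdash MN^1:B$. *)

(* Defs.v *)
From HB Require Import structures.
From mathcomp Require Import all_boot finmap.

Set Implicit Arguments.
Unset Strict Implicit.
Unset Printing Implicit Defensive.

Local Open Scope fset_scope.
Local Open Scope fmap_scope.

Inductive label := strict | irrelevant | unrestricted.

Inductive type (atom : Type) : Type :=
| Base of atom
| Arrow of type atom & label & type atom.

Arguments Base {atom} _.

Definition var := nat.

(* Terms modulo renaming of bound variables, in locally nameless form: free   *)
(* variables are names, bound variables are de Bruijn indices. The terms      *)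
(* proper are the expressions without dangling indices, see [term] below.     *)
Inductive expr (atom const : Type) : Type :=
| Cst of const
| Var of var
| BVar of nat
| Lam of label & type atom & expr atom const
| App of expr atom const & label & expr atom const.

Arguments Cst {atom const} _.
Arguments Var {atom const} _.
Arguments BVar {atom const} _.

Fixpoint close (atom const : Type) (i : nat) (x : var) (M : expr atom const) :
    expr atom const :=
  match M with
  | Cst c => Cst c
  | Var y => if y == x then BVar i else Var y
  | BVar j => BVar j
  | Lam k A M1 => Lam k A (close i.+1 x M1)
  | App M1 k M2 => App (close i x M1) k (close i x M2)
  end.

(* [abs x k A M] is $\lambda x^k{:}A.M$. *)
Definition abs (atom const : Type) (x : var) (k : label) (A : type atom)
    (M : expr atom const) : expr atom const :=
  Lam k A (close 0 x M).

Inductive term (atom const : Type) : expr atom const -> Prop :=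
| term_cst c : term (Cst c)
| term_var x : term (Var x)
| term_abs x k A M : term M -> term (abs x k A M)
| term_app M1 k M2 : term M1 -> term M2 -> term (App M1 k M2).

(* [subst N x M] is $[N/x]M$. When N is a term it has no dangling index, so   *)
(* going under a binder needs no shift and captures nothing.                  *)
Fixpoint subst (atom const : Type) (N : expr atom const) (x : var)
    (M : expr atom const) : expr atom const :=
  match M with
  | Cst c => Cst c
  | Var y => if y == x then N else Var y
  | BVar j => BVar j
  | Lam k A M1 => Lam k A (subst N x M1)
  | App M1 k M2 => App (subst N x M1) k (subst N x M2)
  end.

(* One-step reduction: contraction of a redex anywhere in a term. *)
Inductive beta (atom const : Type) : expr atom const -> expr atom const -> Prop :=
| beta_redex x k A M N :
    term M -> term N -> beta (App (abs x k A M) k N) (subst N x M)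
| beta_abs x k A M M' :
    beta M M' -> beta (abs x k A M) (abs x k A M')
| beta_appl M M' k N :
    beta M M' -> term N -> beta (App M k N) (App M' k N)
| beta_appr M k N N' :
    term M -> beta N N' -> beta (App M k N) (App M k N').

Definition context (atom : Type) := {fmap var -> type atom}.
Definition signature (atom : Type) (const : choiceType) :=
  {fmap const -> type atom}.

Definition emp (atom : Type) : context atom := [fmap].
Arguments emp {atom}.

Definition decl (atom : Type) (x : var) (A : type atom) : context atom :=
  emp.[x <- A].

(* The union [G + H] of finite maps is total, with H overriding G. Every      *)
(* typing rule requires the contexts it mentions to be pairwise disjoint, so  *)
(* that each [+] is a disjoint union and the three zones are disjoint.        *)
Definition disjoint_contexts (atom : Type) (Gs : seq (context atom)) : bool :=
  pairwise (fun G H : context atom => [disjoint domf G & domf H]) Gs.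

Inductive typing (atom : Type) (const : choiceType) (Sg : signature atom const) :
    context atom -> context atom -> context atom ->
    expr atom const -> type atom -> Prop :=
| typing_cst (G O : context atom) c A :
    disjoint_contexts [:: G; O] ->
    Sg.[? c] = Some A ->
    typing Sg G O emp (Cst c) A
| typing_var_u (G O : context atom) x A :
    disjoint_contexts [:: G; decl x A; O] ->
    typing Sg (G + decl x A) O emp (Var x) A
| typing_var_1 (G O : context atom) x A :
    disjoint_contexts [:: G; O; decl x A] ->
    typing Sg G O (decl x A) (Var x) A
| typing_abs_u (G O D : context atom) x A M B :
    disjoint_contexts [:: G; decl x A; O; D] ->
    typing Sg (G + decl x A) O D M B ->
    typing Sg G O D (abs x unrestricted A M) (Arrow A unrestricted B)
| typing_abs_0 (G O D : context atom) x A M B :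
    disjoint_contexts [:: G; O; decl x A; D] ->
    typing Sg G (O + decl x A) D M B ->
    typing Sg G O D (abs x irrelevant A M) (Arrow A irrelevant B)
| typing_abs_1 (G O D : context atom) x A M B :
    disjoint_contexts [:: G; O; D; decl x A] ->
    typing Sg G O (D + decl x A) M B ->
    typing Sg G O D (abs x strict A M) (Arrow A strict B)
| typing_app_u (G O D : context atom) M N A B :
    disjoint_contexts [:: G; O; D] ->
    typing Sg G O D M (Arrow A unrestricted B) ->
    typing Sg (G + D) O emp N A ->
    typing Sg G O D (App M unrestricted N) B
| typing_app_0 (G O D : context atom) M N A B :
    disjoint_contexts [:: G; O; D] ->
    typing Sg G O D M (Arrow A irrelevant B) ->
    typing Sg (G + O + D) emp emp N A ->
    typing Sg G O D (App M irrelevant N) B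
| typing_app_1 (G O DM DN : context atom) M N A B :
    disjoint_contexts [:: G; O; DM; DN] ->
    typing Sg (G + DN) O DM M (Arrow A strict B) ->
    typing Sg (G + DM) O DN N A ->
    typing Sg G O (DM + DN) (App M strict N) B.

(* Main.v *)
Require Import Defs.
From mathcomp Require Import all_boot finmap.

(* A context triple is read as one environment giving each variable a label   *)
(* and a type, and each of the three application rules splits an environment  *)
(* between function and argument, by a pointwise relation that depends only   *)
(* on the label of the arrow. In this form the three substitution principles  *)
(* are one: if [e] splits at label [k] into [e1] and [e2], the body is typed  *)
(* in [e1] extended with [x : A] labelled [k], and [N : A] in [e2], then      *)
(* [N/x] of the body is typed in [e]. Its application case is an exchange     *)
(* property of splittings, a finite check on labels; loosening (moving a      *)
(* declaration to the unrestricted zone) and weakening supply the copies of   *)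
(* [N] that the exchange needs. The environment also assigns entries to the   *)
(* dangling de Bruijn indices of raw expressions, so going under a binder     *)
(* requires no choice of a name.                                              *)

Set Implicit Arguments.
Unset Strict Implicit.
Unset Printing Implicit Defensive.

Local Open Scope fset_scope.
Local Open Scope fmap_scope.

(** A strict variable must be reached by a path through functions and strict arguments: every
    application on the way hands it to one side as strict and to the other as unrestricted, and a
    leaf admits no strict variable but itself. Contracting a strict redex puts the argument where
    such a path to the bound variable ends. The argument's strict variables are reached there, and
    all its other copies see them as unrestricted. At the labels [unrestricted] and [irrelevant] the
    argument holds no strict variable, so it may be copied or erased; in the irrelevant case the
    bound variable occurs only inside irrelevant arguments, where everything is unrestricted, which
    is how its substitute was typed.

    [wt_subst] turns this into an induction, with [split_at_split] for applications. [wt_rename]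
    yields weakening and all changes of bound names, and [wt_beta] adds reduction inside a term.
    [typing_wt] and [wt_typing] translate between the three zones and environments. *)

(** * Indices and renamings *)

Definition index := (var + nat)%type.

Definition index_shift (i : index) : index :=
  match i with inl x => inl x | inr j => inr j.+1 end.

Definition index_unshift (i : index) : option index :=
  match i with
  | inl x => Some (inl x)
  | inr 0 => None
  | inr j.+1 => Some (inr j)
  end.

Lemma index_shiftK : pcancel index_shift index_unshift.
Proof. by case. Qed.

Lemma index_unshiftK i j : index_unshift i = Some j -> i = index_shift j.
Proof. by case: i => [x|[|n]] //= [<-]. Qed.

Definition lift (f : index -> index) (i : index) : index :=
  if index_unshift i is Some j then index_shift (f j) else inr 0.

Definition plift (g : index -> option index) (i : index) : option index :=
  if index_unshift i is Some j then omap index_shift (g j) else Some (inr 0).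

Definition var_of_index (atom const : Type) (i : index) : expr atom const :=
  match i with inl x => Var x | inr j => BVar j end.

Fixpoint rename (atom const : Type) (f : index -> index) (M : expr atom const) :
    expr atom const :=
  match M with
  | Cst c => Cst c
  | Var x => var_of_index _ _ (f (inl x))
  | BVar j => var_of_index _ _ (f (inr j))
  | Lam k A M1 => Lam k A (rename (lift f) M1)
  | App M1 k M2 => App (rename f M1) k (rename f M2)
  end.

(** * Labels, splittings and typing in an environment *)

Definition nonstrict (l : label) := if l is strict then false else true.

(* In an application [M N^k], a variable labelled [l] becomes [l1] in [M] and  *)
(* [l2] in [N].                                                               *)
Definition lsplit (k l l1 l2 : label) : bool :=
  match k, l, l1, l2 with
  | unrestricted, strict, strict, unrestricted
  | unrestricted, irrelevant, irrelevant, irrelevant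
  | irrelevant, strict, strict, unrestricted
  | irrelevant, irrelevant, irrelevant, unrestricted
  | strict, strict, strict, unrestricted
  | strict, strict, unrestricted, strict
  | strict, irrelevant, irrelevant, irrelevant
  | _, unrestricted, unrestricted, unrestricted => true
  | _, _, _, _ => false
  end.

Definition lle (l l' : label) : bool :=
  match l, l' with
  | _, unrestricted | strict, strict | irrelevant, irrelevant => true
  | _, _ => false
  end.

Definition entry (atom : Type) := option (label * type atom).

Definition osplit (atom : Type) (k : label) (o o1 o2 : entry atom) : Prop :=
  match o, o1, o2 with
  | None, None, None => True
  | Some (l, A), Some (l1, A1), Some (l2, A2) =>
      [/\ lsplit k l l1 l2, A1 = A & A2 = A]
  | _, _, _ => False
  end.

Definition ononstrict (atom : Type) (o : entry atom) : bool :=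
  if o is Some (l, _) then nonstrict l else true.

(* Besides loosening a label, an entry may appear, provided it is not strict. *)
Definition ole (atom : Type) (o o' : entry atom) : Prop :=
  match o, o' with
  | None, _ => ononstrict o'
  | Some (l, A), Some (l', A') => lle l l' /\ A = A'
  | Some _, None => False
  end.

Definition env (atom : Type) := index -> entry atom.

Definition push (atom : Type) (p : label * type atom) (e : env atom) : env atom :=
  fun i => if index_unshift i is Some j then e j else Some p.

Definition uses (atom : Type) (e : env atom) (i : index) (A : type atom) :=
  [/\ exists2 l, e i = Some (l, A) & l <> irrelevant
    & forall j, j <> i -> ononstrict (e j)].

(** Recursion on the expression makes inversion a computation, also at a binder, where inverting
    [typing] yields a body only up to the choice of the bound name. *)
Fixpoint wt (atom : Type) (const : choiceType) (Sg : signature atom const)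
    (e : env atom) (M : expr atom const) (B : type atom) : Prop :=
  match M with
  | Cst c => (forall i, ononstrict (e i)) /\ Sg.[? c] = Some B
  | Var x => uses e (inl x) B
  | BVar j => uses e (inr j) B
  | Lam k A M1 => exists2 B1, B = Arrow A k B1 & wt Sg (push (k, A) e) M1 B1
  | App M1 k M2 => exists e1 e2 A,
      [/\ forall i, osplit k (e i) (e1 i) (e2 i),
          wt Sg e1 M1 (Arrow A k B) & wt Sg e2 M2 A]
  end.

(** * Typing is stable under renaming and loosening *)

(** At a strict arrow a strict entry splits in two ways, so the parts of an enlarged entry are
    computed from the old parts and not from the entry alone. *)
Definition raise_fst (atom : Type) (o o' o1 : entry atom) : entry atom :=
  match o, o' with
  | Some _, Some (unrestricted, _) | None, _ => o'
  | _, _ => o1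
  end.

Definition raise_snd (atom : Type) k (o o' o2 : entry atom) : entry atom :=
  match o, o' with
  | Some _, Some (unrestricted, _) => o'
  | Some _, _ => o2
  | None, Some (irrelevant, A) =>
      Some (if k is irrelevant then unrestricted else irrelevant, A)
  | None, _ => o'
  end.

Lemma osplit_raise (atom : Type) k (o o' o1 o2 : entry atom) :
  osplit k o o1 o2 -> ole o o' ->
  [/\ osplit k o' (raise_fst o o' o1) (raise_snd k o o' o2),
      ole o1 (raise_fst o o' o1) & ole o2 (raise_snd k o o' o2)].
Proof.
case: o => [[l A]|]; last first.
  by case: o1 => //; case: o2 => // _; case: o' => [[[] A']|] //; case: k.
case: o1 => [[l1 A1]|] //; case: o2 => [[l2 A2]|] //= [H -> ->].
case: o' => [[l' A']|] //= [H' ->]; move: H H'.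
by case: k; case: l => //; case: l1 => //; case: l2 => //; case: l'.
Qed.

Lemma uses_rename (atom : Type) (const : choiceType) (Sg : signature atom const)
    f g (e e' : env atom) i B :
  (forall i, e i -> g (f i) = Some i) -> (forall i j, g j = Some i -> f i = j) ->
  (forall j, ole (obind e (g j)) (e' j)) ->
  uses e i B -> wt Sg e' (var_of_index _ _ (f i)) B.
Proof.
move=> fK gK le [[l ei Hl] Hn].
suff: uses e' (f i) B by case: (f i).
have gfi : g (f i) = Some i by apply: fK; rewrite ei.
split=> [|j ji].
  move: (le (f i)); rewrite gfi /= ei; case: (e' _) => [[l' A']|] //= [Hl' <-].
  by exists l' => //; move: Hl Hl'; case: l {ei}; case: l'.
move: (le j); case Eg: (g j) => [i'|] //=.
have: ononstrict (e i') by apply: Hn => E; apply: ji; rewrite -(gK _ _ Eg) E.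
case: (e i') => [[l1 A1]|] //=; case: (e' j) => [[l2 A2]|] //=.
by case: l1; case: l2 => // _ [].
Qed.

(* [f] need only be injective where [e] is defined, so opening at a fresh     *)
(* name is an instance.                                                       *)
Lemma wt_rename (atom : Type) (const : choiceType) (Sg : signature atom const)
    (f : index -> index) (g : index -> option index) (e e' : env atom) M B :
  (forall i, e i -> g (f i) = Some i) -> (forall i j, g j = Some i -> f i = j) ->
  (forall j, ole (obind e (g j)) (e' j)) ->
  wt Sg e M B -> wt Sg e' (rename f M) B.
Proof.
elim: M f g e e' B => [c|x|n|k A M IH|M1 IH1 k M2 IH2] f g e e' B fK gK le /=.
- move=> [He ->]; split=> // j; move: (le j).
  case: (g j) => [i|] //=; move: (He i); case: (e i) => [[l A]|] //=.
  by case: (e' j) => [[l' A']|] //=; case: l; case: l' => // _ [].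
- exact: uses_rename fK gK le.
- exact: uses_rename fK gK le.
- move=> [B1 -> H]; exists B1 => //; apply: (IH _ (plift g)) H.
  + move=> i; rewrite /push /lift /plift; case Ei: (index_unshift i) => [j|] ej.
      by rewrite index_shiftK fK //= (index_unshiftK Ei).
    by case: i Ei ej => [|[]].
  + move=> i j; rewrite /lift /plift; case Ej: (index_unshift j) => [j'|].
      case Eg: (g j') => [i'|] //= [<-].
      by rewrite index_shiftK (gK _ _ Eg) (index_unshiftK Ej).
    by case=> <-; case: j Ej => [|[]].
  + move=> j; rewrite /push /plift; case Ej: (index_unshift j) => [j'|] /=.
      by move: (le j'); case: (g j') => [i|] //=; rewrite index_shiftK.
    by split=> //; case: (k).
- move=> [e1 [e2 [A [He H1 H2]]]].
  have Hr j : osplit k (obind e (g j)) (obind e1 (g j)) (obind e2 (g j)).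
    by case: (g j) => [i|] //=.
  have He1 i : e1 i -> e i by move: (He i); case: (e i) => //; case: (e1 i).
  have He2 i : e2 i -> e i.
    by move: (He i); case: (e i) => //; case: (e1 i) => //; case: (e2 i).
  exists (fun j => raise_fst (obind e (g j)) (e' j) (obind e1 (g j))).
  exists (fun j => raise_snd k (obind e (g j)) (e' j) (obind e2 (g j))).
  exists A; split=> [j||]; first by have [] := osplit_raise (Hr j) (le j).
    apply: IH1 gK _ H1 => [i /He1/fK //|j].
    by have [] := osplit_raise (Hr j) (le j).
  apply: IH2 gK _ H2 => [i /He2/fK //|j].
  by have [] := osplit_raise (Hr j) (le j).
Qed.

(** * Local closure; opening and closing as renamings *)

Fixpoint lc (atom const : Type) (n : nat) (M : expr atom const) : bool :=
  match M with
  | Cst _ | Var _ => true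
  | BVar j => j < n
  | Lam _ _ M1 => lc n.+1 M1
  | App M1 _ M2 => lc n M1 && lc n M2
  end.

Fixpoint fresh (atom const : Type) (y : var) (M : expr atom const) : bool :=
  match M with
  | Cst _ | BVar _ => true
  | Var x => x != y
  | Lam _ _ M1 => fresh y M1
  | App M1 _ M2 => fresh y M1 && fresh y M2
  end.

Lemma fresh_bound (atom const : Type) (M : expr atom const) :
  exists n, forall y, n <= y -> fresh y M.
Proof.
elim: M => [c|x|j|k A M [n IH]|M1 [n1 IH1] k M2 [n2 IH2]] /=.
- by exists 0.
- by exists x.+1 => y; case: ltngtP.
- by exists 0.
- by exists n.
- by exists (maxn n1 n2) => y; rewrite geq_max => /andP[/IH1-> /IH2->].
Qed.

Lemma lc_close (atom const : Type) n x (M : expr atom const) :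
  lc n M -> lc n.+1 (close n x M).
Proof.
elim: M n => [c|y|j|k A M IH|M1 IH1 k M2 IH2] n //=.
- by case: eqP => //= _.
- by move=> /ltnW.
- exact: IH.
- by move=> /andP[/IH1-> /IH2->].
Qed.

Lemma term_lc (atom const : Type) (M : expr atom const) : term M -> lc 0 M.
Proof. by elim=> //= [x k A M1 _ /lc_close->|M1 k M2 _ -> _ ->]. Qed.

Lemma lc_le (atom const : Type) m n (M : expr atom const) :
  m <= n -> lc m M -> lc n M.
Proof.
elim: M m n => [c|y|j|k A M IH|M1 IH1 k M2 IH2] m n //= mn.
- by move=> /leq_trans; apply.
- exact: IH.
- by move=> /andP[/(IH1 _ _ mn)-> /(IH2 _ _ mn)->].
Qed.

Lemma lc_subst (atom const : Type) n x (M N : expr atom const) :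
  lc n M -> lc 0 N -> lc n (subst N x M).
Proof.
move=> + HN; elim: M n => [c|y|j|k A M IH|M1 IH1 k M2 IH2] n //=.
- by case: eqP => //= _ _; apply: lc_le HN.
- exact: IH.
- by move=> /andP[/IH1-> /IH2->].
Qed.

Lemma beta_lc (atom const : Type) (M M' : expr atom const) :
  beta M M' -> lc 0 M && lc 0 M'.
Proof.
elim=> {M M'} /= [x k A M N /term_lc HM /term_lc HN|x k A M M' _ /andP[H H']|
  M M' k N _ /andP[-> ->] /term_lc-> //|M k N N' /term_lc-> _ /andP[-> ->] //].
- by rewrite lc_close // HN lc_subst.
- by rewrite !lc_close.
Qed.

Lemma rename_id (atom const : Type) n f (M : expr atom const) :
  lc n M -> (forall x, f (inl x) = inl x) -> (forall j, j < n -> f (inr j) = inr j) ->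
  rename f M = M.
Proof.
elim: M n f => [c|y|j|k A M IH|M1 IH1 k M2 IH2] n f //= HM fx fj.
- by rewrite fx.
- by rewrite fj.
- rewrite (IH n.+1) // => [x|[|j]] //; first by rewrite /lift /= fx.
  by rewrite /lift /= ltnS => /fj->.
- by case/andP: HM => HM1 HM2; rewrite (IH1 n) // (IH2 n).
Qed.

(** Only names occurring in [M] have to be fixed: reduction under a binder uses a renaming that
    moves a name fresh for the reduct. *)
Lemma rename_close (atom const : Type) n f x (M : expr atom const) :
  lc n M -> f (inl x) = inr n ->
  (forall y, y <> x -> ~~ fresh y M -> f (inl y) = inl y) ->
  (forall j, j < n -> f (inr j) = inr j) ->
  rename f M = close n x M.
Proof.
elim: M n f => [c|y|j|k A M IH|M1 IH1 k M2 IH2] n f //= HM fx fy fj.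
- by case: eqP => [->|H]; [rewrite fx | rewrite fy // negbK].
- by rewrite fj.
- rewrite (IH n.+1) // => [|y yx Hy|[|j]] //; rewrite /lift /= ?fx ?fy //.
  by rewrite ltnS => /fj->.
- case/andP: HM => HM1 HM2; rewrite (IH1 n) ?(IH2 n) // => y yx Hy;
  by rewrite fy // negb_and Hy ?orbT.
Qed.

Lemma rename_closeK (atom const : Type) n f x (M : expr atom const) :
  lc n M -> f (inr n) = inl x ->
  (forall y, y <> x -> f (inl y) = inl y) ->
  (forall j, j < n -> f (inr j) = inr j) ->
  rename f (close n x M) = M.
Proof.
elim: M n f => [c|y|j|k A M IH|M1 IH1 k M2 IH2] n f //= HM fx fy fj.
- by case: eqP => [->|H] /=; [rewrite fx | rewrite fy].
- by rewrite fj.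
- rewrite (IH n.+1) // => [|y yx|[|j]] //; rewrite /lift /= ?fx ?fy //.
  by rewrite ltnS => /fj->.
- by case/andP: HM => HM1 HM2; rewrite (IH1 n) // (IH2 n).
Qed.

Lemma close_renameK (atom const : Type) n f y (M : expr atom const) :
  lc n.+1 M -> fresh y M -> f (inr n) = inl y ->
  (forall x, f (inl x) = inl x) -> (forall j, j < n -> f (inr j) = inr j) ->
  close n y (rename f M) = M.
Proof.
elim: M n f => [c|x|j|k A M IH|M1 IH1 k M2 IH2] n f //= HM Hy fn fx fj.
- by rewrite fx /= (negbTE Hy).
- move: HM; rewrite ltnS leq_eqVlt => /predU1P[->|/fj-> //].
  by rewrite fn /= eqxx.
- rewrite IH // => [|x|[|j]] //; rewrite /lift /= ?fn ?fx //.
  by rewrite ltnS => /fj->.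
- by case/andP: HM => ? ?; case/andP: Hy => ? ?; rewrite IH1 // IH2.
Qed.

(** The name [x] of a redex may also be declared in the environment; this trades it for a fresh
    [y]. *)
Lemma subst_rename_close (atom const : Type) n f x y (M N : expr atom const) :
  lc n M -> fresh y M -> f (inr n) = inl y ->
  (forall z, f (inl z) = inl z) -> (forall j, j < n -> f (inr j) = inr j) ->
  subst N y (rename f (close n x M)) = subst N x M.
Proof.
elim: M n f => [c|z|j|k A M IH|M1 IH1 k M2 IH2] n f //= HM Hy fn fx fj.
- case: (z =P x) => [|_] /=; first by rewrite fn /= eqxx.
  by rewrite fx /= (negbTE Hy).
- by rewrite fj.
- rewrite (IH n.+1) // => [|z|[|j]] //; rewrite /lift /= ?fn ?fx //.
  by rewrite ltnS => /fj->.
- by case/andP: HM => ? ?; case/andP: Hy => ? ?; rewrite (IH1 n) // (IH2 n).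
Qed.

(** * Weakening, exchange of splittings, and substitution *)

Lemma wt_weaken (atom : Type) (const : choiceType) (Sg : signature atom const)
    (e e' : env atom) M B :
  (forall i, ole (e i) (e' i)) -> wt Sg e M B -> wt Sg e' M B.
Proof.
move=> le; have [n Hn] : exists n, lc n M.
  elim: M => [c|x|j|k A M [n IH]|M1 [n1 IH1] k M2 [n2 IH2]] /=.
  - by exists 0.
  - by exists 0.
  - by exists j.+1.
  - by exists n; apply: lc_le IH.
  - exists (maxn n1 n2).
    by rewrite (lc_le (leq_maxl _ _) IH1) (lc_le (leq_maxr _ _) IH2).
rewrite -{2}(rename_id (f := id) Hn) //.
by apply: (wt_rename (g := Some)) => // i j [].
Qed.

(** Shifting indices does not change a locally closed [N], so going under a binder is a renaming
    that adds an entry which [N] does not use. *)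
Lemma wt_push (atom : Type) (const : choiceType) (Sg : signature atom const)
    p (e : env atom) N B :
  nonstrict p.1 -> lc 0 N -> wt Sg e N B -> wt Sg (push p e) N B.
Proof.
move=> Hp HN; rewrite -{2}(rename_id (f := index_shift) HN) //.
apply: (wt_rename (g := index_unshift)) => [i _|i j /index_unshiftK //|j].
  exact: index_shiftK.
rewrite /push; case: (index_unshift j) => [i|] /=; last by case: p Hp.
by case: (e i) => [[[] A]|].
Qed.

(* The new labels in the exchange of splittings: [l] splits at [k] into [l1]  *)
(* and [l2], and [l1] splits at [k'] into [l11] and [l12], while the          *)
(* substituted variable, labelled [k], splits at [k'] into [k1] and [k2].     *)
(* Then [share] and [share'] split [l] at [k'], sending a strict variable of  *)
(* the substitute wherever the substituted variable is strict, and [rest] is  *)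
(* what the first part leaves over.                                           *)
Definition share (k l k1 l2 l11 : label) : label :=
  match k, l with
  | strict, strict => if l2 is strict then k1 else l11
  | _, _ => l
  end.

Definition loosen (l : label) : label :=
  if l is strict then unrestricted else l.

Definition share' (k l k2 l2 l12 : label) : label :=
  match k, l with
  | strict, strict => if l2 is strict then k2 else l12
  | irrelevant, _ => unrestricted
  | _, _ => loosen l
  end.

Definition rest (k l l1 : label) : label :=
  match k, l, l1 with
  | irrelevant, _, _ => unrestricted
  | strict, strict, unrestricted => strict
  | _, _, _ => loosen l
  end.

(** The two inequalities give each side of the application its own copy of the substitute, by
    weakening from [l2] to [n1] and to [n2]. *)
Lemma lsplit_lsplit k k' k1 k2 l l1 l2 l11 l12 :
  lsplit k' k k1 k2 -> lsplit k l l1 l2 -> lsplit k' l1 l11 l12 ->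
  let la := share k' l k1 l2 l11 in let lb := share' k' l k2 l2 l12 in
  let n1 := rest k1 la l11 in let n2 := rest k2 lb l12 in
  [/\ lsplit k' l la lb, lsplit k1 la l11 n1, lle l2 n1,
      lsplit k2 lb l12 n2 & lle l2 n2].
Proof.
by case: k; case: k'; case: k1 => //; case: k2 => // _; case: l; case: l1 => //;
  case: l2 => // _; case: l11 => //; case: l12.
Qed.

Definition label_of (atom : Type) (o : entry atom) : label :=
  if o is Some (l, _) then l else unrestricted.

Definition relabel (atom : Type) (l : label) (o : entry atom) : entry atom :=
  omap (fun p => (l, p.2)) o.

Definition split_at (atom : Type) x A k (e e1 e2 : env atom) : Prop :=
  forall i, if i == inl x then [/\ e i = None, e1 i = Some (k, A) & e2 i = None]
            else osplit k (e i) (e1 i) (e2 i).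

(** Apply [lsplit_lsplit] at every index other than [x]. The labels [k1] and [k2] that [x] receives
    in [e11] and [e12] become the labels of the two new splittings. *)
Lemma split_at_split (atom : Type) x A k k' (e e1 e2 e11 e12 : env atom) :
  split_at x A k e e1 e2 -> (forall i, osplit k' (e1 i) (e11 i) (e12 i)) ->
  exists k1 k2 ea eb n1 n2,
  [/\ forall i, osplit k' (e i) (ea i) (eb i),
      split_at x A k1 ea e11 n1 /\ (forall i, ole (e2 i) (n1 i)) &
      split_at x A k2 eb e12 n2 /\ (forall i, ole (e2 i) (n2 i))].
Proof.
move=> He He1; have := He (inl x); rewrite eqxx => -[ex e1x e2x].
have := He1 (inl x); rewrite e1x.
case E11: (e11 _) => [[k1 A1]|] //; case E12: (e12 _) => [[k2 A2]|] //=.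
move=> [Hk ? ?]; subst A1 A2; exists k1, k2.
pose la i := share k' (label_of (e i)) k1 (label_of (e2 i)) (label_of (e11 i)).
pose lb i := share' k' (label_of (e i)) k2 (label_of (e2 i)) (label_of (e12 i)).
pose ln1 i := rest k1 (la i) (label_of (e11 i)).
pose ln2 i := rest k2 (lb i) (label_of (e12 i)).
exists (fun i => relabel (la i) (e i)), (fun i => relabel (lb i) (e i)).
exists (fun i => relabel (ln1 i) (e i)), (fun i => relabel (ln2 i) (e i)).
have H i : i != inl x ->
    [/\ osplit k' (e i) (relabel (la i) (e i)) (relabel (lb i) (e i)),
        osplit k1 (relabel (la i) (e i)) (e11 i) (relabel (ln1 i) (e i)),
        ole (e2 i) (relabel (ln1 i) (e i)),
        osplit k2 (relabel (lb i) (e i)) (e12 i) (relabel (ln2 i) (e i))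
      & ole (e2 i) (relabel (ln2 i) (e i))].
  move=> ix; move: (He i) (He1 i); rewrite (negbTE ix) /ln1 /ln2 /la /lb.
  case: (e i) => [[l B]|]; case: (e1 i) => [[l1 B1]|] //;
    case: (e2 i) => [[l2 B2]|] //; last first.
    by case: (e11 i) => //; case: (e12 i).
  move=> /= [Hl -> ->]; case: (e11 i) => [[l11 B11]|] //.
  case: (e12 i) => [[l12 B12]|] //= [Hl1 -> ->].
  by have [] := lsplit_lsplit Hk Hl Hl1; split.
split.
- move=> i; case: (i =P inl x) => [->|/eqP/H[] //].
  by rewrite ex.
- split=> i; case: (i =P inl x) => [->|/eqP/H[] //]; first by rewrite ex E11.
  by rewrite e2x ex.
- split=> i; case: (i =P inl x) => [->|/eqP/H[] //]; first by rewrite ex E12.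
  by rewrite e2x ex.
Qed.

(** A non-strict argument discharges no strict variable: each one stays strict in the function. *)
Lemma split_at_nonstrict (atom : Type) x A k (e e1 e2 : env atom) i :
  split_at x A k e e1 e2 -> nonstrict k -> ononstrict (e1 i) -> ononstrict (e i).
Proof.
move=> /(_ i); case: eqP => [_ [->]|_] //.
case: (e i) => [[l B]|] //; case: (e1 i) => [[l1 B1]|] //.
by case: (e2 i) => [[l2 B2]|] //= [+ _ _]; case: k => //; case: l => //; case: l1.
Qed.

Lemma wt_subst (atom : Type) (const : choiceType) (Sg : signature atom const)
    x A k (e e1 e2 : env atom) M N B :
  split_at x A k e e1 e2 -> lc 0 N ->
  wt Sg e1 M B -> wt Sg e2 N A -> wt Sg e (subst N x M) B.
Proof.
move=> + HN; elim: M k e e1 e2 B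
    => [c|y|j|k' A' M IH|M1 IH1 k' M2 IH2] k e e1 e2 B He /=.
- move=> [H ->] _; split=> // i.
  apply: (split_at_nonstrict He _ (H i)).
  by move: (He (inl x)) (H (inl x)); rewrite eqxx => -[_ -> _].
- move=> [[l ey Hl] H] H2; case: (y =P x) => [yx|yx].
    subst y; have := He (inl x); rewrite eqxx => -[ex e1x e2x].
    move: ey; rewrite e1x => -[? ?]; subst l B.
    (* The entries of [e1] other than [x] are not strict, so each strict entry of [e] is strict in
       [e2]; as [k] is not irrelevant, [e] only loosens [e2]. *)
    apply: wt_weaken H2 => i; move: (He i) (H i).
    case: eqP => [->|ix]; first by rewrite ex e2x.
    case: (e i) => [[l C]|] //; case: (e1 i) => [[l1 C1]|] //;
      case: (e2 i) => [[l2 C2]|] //= [Hs _ ->] /(_ ix) Hl1; split=> //.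
    by move: Hl Hs Hl1; case: k {He e1x H} => //; case: l => //; case: l1 => //;
      case: l2.
  (* The leaf is not [x], so [x] is not strict; for such [k] the function part of a splitting keeps
     every label. *)
  have Hk : nonstrict k.
    have xy : inl x <> inl y :> index by move=> [] /esym.
    by move: (He (inl x)) (H _ xy); rewrite eqxx => -[_ -> _].
  split=> [|i iy]; last exact: split_at_nonstrict He Hk (H _ iy).
  move: (He (inl y)); case: eqP => [[] //|_]; rewrite ey.
  case: (e _) => [[l1 C]|] //; case: (e2 _) => [[l2 C2]|] //= [Hs -> _].
  exists l1 => //; move: Hs Hk Hl.
  by case: k {He H} => //; case: l1 => //; case: l {ey}.
- move=> [[l ej Hl] H] _.
  have Hk : nonstrict k.
    have xj : inl x <> inr j :> index by [].
    by move: (He (inl x)) (H _ xj); rewrite eqxx => -[_ -> _].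
  split=> [|i ij]; last exact: split_at_nonstrict He Hk (H _ ij).
  move: (He (inr j)) => /=; rewrite ej.
  case: (e _) => [[l1 C]|] //; case: (e2 _) => [[l2 C2]|] //= [Hs -> _].
  exists l1 => //; move: Hs Hk Hl.
  by case: k {He H} => //; case: l1 => //; case: l {ej}.
- move=> [B1 -> H] H2; exists B1 => //.
  (* The bound variable's label in [N]: splitting [k'] at [k] gives [k'] and [l2], and [l2] is not
     strict. *)
  pose l2 := if k is irrelevant then unrestricted else loosen k'.
  apply: IH H (wt_push (p := (l2, A')) _ HN H2); last first.
    by rewrite /l2; case: (k); case: (k').
  move=> [y|[|j]]; first exact: (He (inl y)); last exact: (He (inr j)).
  by rewrite /push /= /l2; split=> //; case: (k); case: (k').
- move=> [e11 [e12 [C [Hs H1 H2]]]] H.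
  have [k1 [k2 [ea [eb [n1 [n2 [Hab [Ha Hn1] [Hb Hn2]]]]]]]] :=
    split_at_split He Hs.
  exists ea, eb, C; split=> //.
    by apply: IH1 Ha H1 _; apply: wt_weaken H.
  by apply: IH2 Hb H2 _; apply: wt_weaken H.
Qed.

(** * Opening, closing and reduction in an environment *)

Definition open_index (y : var) (i : index) : index :=
  match i with inl z => inl z | inr 0 => inl y | inr j.+1 => inr j end.

Definition update (atom : Type) (e : env atom) (y : var) p : env atom :=
  fun i => if i == inl y then Some p else e i.

Lemma ole_refl (atom : Type) (o : entry atom) : ole o o.
Proof. by case: o => [[[] A]|]. Qed.

Lemma wt_open (atom : Type) (const : choiceType) (Sg : signature atom const)
    (e : env atom) y p M B :
  e (inl y) = None -> wt Sg (push p e) M B ->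
  wt Sg (update e y p) (rename (open_index y) M) B.
Proof.
move=> ey; pose g (i : index) : option index :=
  match i with
  | inl z => Some (if z == y then inr 0 else inl z)
  | inr j => Some (inr j.+1)
  end.
apply: (wt_rename (g := g)).
- case=> [z|[|j]] //=; last by rewrite eqxx.
  by case: eqP => // ->; rewrite /push /= ey.
- by move=> i [w|j] [<-] //=; case: eqP => [->|].
- case=> [z|j]; rewrite /update /push /=; last exact: ole_refl.
  by rewrite (inj_eq inl_inj); case: eqP => _; apply: ole_refl.
Qed.

Lemma wt_close (atom : Type) (const : choiceType) (Sg : signature atom const)
    (e e' : env atom) x p M B :
  e (inl x) = None -> (forall i, e' i = update e x p i) -> lc 0 M ->
  wt Sg e' M B -> wt Sg (push p e) (close 0 x M) B.
Proof.
move=> ex He' HM; pose f (i : index) : index :=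
  match i with inl z => if z == x then inr 0 else inl z | inr j => inr j.+1 end.
pose g (i : index) : option index :=
  match i with
  | inl z => if z == x then None else Some (inl z)
  | inr 0 => Some (inl x)
  | inr j.+1 => Some (inr j)
  end.
rewrite -(rename_close (n := 0) (f := f) HM) //=; first last.
- by move=> y /eqP/negbTE /= ->.
- by rewrite eqxx.
apply: (wt_rename (g := g)).
- by case=> [z|j] //= _; case: (z =P x) => [->|/eqP/negbTE /= ->].
- move=> i [w|[|j]] //=; [|by case=> <-; rewrite /= eqxx|by case=> <-].
  by case: (w =P x) => // /eqP/negbTE wx [<-]; rewrite /= wx.
- case=> [z|[|j]] /=; rewrite /push /=.
  + case: (z =P x) => [->|/eqP/negbTE zx]; first by rewrite ex.
    by rewrite /obind /oapp He' /update (inj_eq inl_inj) zx; apply: ole_refl.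
  + by rewrite He' /update eqxx; apply: (ole_refl (Some p)).
  + by rewrite He'; apply: ole_refl.
Qed.

(** An environment is an arbitrary function on indices, so a supply of fresh names is an invariant
    to be carried through the induction. *)
Definition bounded (atom : Type) (e : env atom) :=
  exists n, forall x, n <= x -> e (inl x) = None.

Lemma wt_beta (atom : Type) (const : choiceType) (Sg : signature atom const)
    (e : env atom) M M' B :
  beta M M' -> bounded e -> wt Sg e M B -> wt Sg e M' B.
Proof.
move=> Hb; elim: Hb e B => {M M'} [x k A M N /term_lc HM /term_lc HN
  |x k A M M' Hb IH|M M' k N _ IH _|M k N N' _ _ IH] e B [n He] /=.
- move=> [e1 [e2 [A' [Hs [B1 [? ? H1] H2]]]]]; subst A' B1.
  have [m Hm] := fresh_bound M; set y := maxn n m.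
  have {}Hm : fresh y M by apply/Hm/leq_maxr.
  have ey : e (inl y) = None by apply/He/leq_maxl.
  have [e1y e2y] : e1 (inl y) = None /\ e2 (inl y) = None.
    by move: (Hs (inl y)); rewrite ey; case: (e1 _) => //; case: (e2 _).
  rewrite -(subst_rename_close (n := 0) (f := open_index y) x N HM Hm) //.
  apply: (wt_subst (k := k)) HN (wt_open e1y H1) H2 => i.
  by rewrite /update; case: eqP => [->|].
- move=> [B1 -> H]; exists B1 => //.
  have /andP[HM HM'] := beta_lc Hb.
  have [m Hm] := fresh_bound M'; set y := (maxn x.+1 (maxn n m)).
  have {}Hm : fresh y M' by apply/Hm; rewrite /y !leq_max leqnn !orbT.
  have ey : e (inl y) = None by apply/He; rewrite /y !leq_max leqnn !orbT.
  have xy : x != y by rewrite ltn_eqF // leq_max leqnn.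
  (* The outer environment may declare [x] too. So [f] opens the body at [x] and moves the outer [x]
     to the fresh [y]; [f'] undoes this after the reduction. *)
  pose f (i : index) : index :=
    match i with
    | inl z => inl (if z == x then y else z)
    | inr 0 => inl x
    | inr j.+1 => inr j
    end.
  pose f' (i : index) : index :=
    match i with
    | inl z => if z == x then inr 0 else if z == y then inl x else inl z
    | inr j => inr j.+1
    end.
  pose g' (i : index) : option index :=
    if i == inl y then None else Some (f i).
  have ff' : cancel f' f.
    case=> [z|j] //=; case: (z =P x) => [-> //|/eqP zx].
    by case: (z =P y) => [->|_] /=; rewrite ?eqxx ?(negbTE zx).
  have f'f i : i <> inl y -> f' (f i) = i.
    case: i => [z|[|j]] //=; last by rewrite eqxx.
    case: (z =P x) => [->|/eqP zx]; first by rewrite eq_sym (negbTE xy) eqxx.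
    by rewrite (negbTE zx); case: eqP => // -> [].
  (* On names, [f'] differs from closing at [x] only at [y], which does not occur in the reduct. *)
  rewrite -(rename_close (n := 0) (f := f') (x := x) HM') //; first last.
    move=> z /eqP/negbTE /= -> Hz; case: eqP => // zy.
    by rewrite zy Hm in Hz.
    by rewrite /= eqxx.
  apply: (wt_rename (e := fun i => push (k, A) e (f' i)) (g := g')).
  + move=> i _; rewrite /g' ff'; case: eqP => // E.
    have Ei : i = inl y by rewrite -(ff' i) E /= eq_sym (negbTE xy).
    move: E; rewrite Ei /= eq_sym (negbTE xy) eqxx => -[E].
    by rewrite E eqxx in xy.
  + by move=> i j; rewrite /g'; case: eqP => // jy [<-]; apply: f'f.
  + move=> j; rewrite /g'; case: eqP => [->|jy] /=; first by rewrite /push /= ey.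
    by rewrite f'f //; apply: ole_refl.
  apply: IH.
    exists y.+1 => z yz; have zx : z == x = false.
      by rewrite gtn_eqF // (leq_trans _ yz) // ltnS ltnW // leq_max leqnn.
    rewrite /push /= zx gtn_eqF //= He //.
    by apply/ltnW/(leq_trans _ yz); rewrite ltnS !leq_max leqnn orbT.
  rewrite -(rename_closeK (n := 0) (f := f) (x := x) HM) //.
    apply: (wt_rename (g := fun i => Some (f' i))) H => [i Hi|i j [<-]|j];
      [|exact: ff'|exact: ole_refl].
    by rewrite f'f // => Ei; move: Hi; rewrite Ei /push /= ey.
  by move=> z /eqP/negbTE /= ->.
- move=> [e1 [e2 [A [Hs H1 H2]]]]; exists e1, e2, A; split=> //; apply: IH => //.
  by exists n => z /He; move: (Hs (inl z)); case: (e _) => //; case: (e1 _).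
- move=> [e1 [e2 [A [Hs H1 H2]]]]; exists e1, e2, A; split=> //; apply: IH => //.
  exists n => z /He; move: (Hs (inl z)); case: (e _) => //; case: (e1 _) => //.
  by case: (e2 _).
Qed.

(** * Translation between the three zones and environments *)

(** Read pointwise, disjointness becomes a case analysis on the lookups of one name. *)
Lemma disjoint_contextsP (atom : Type) (Gs : seq (context atom)) :
  reflect (forall x, pairwise (fun G H : context atom => ~~ (G.[? x] && H.[? x])) Gs)
          (disjoint_contexts Gs).
Proof.
have disjP (G H : context atom) :
    reflect (forall x, ~~ (G.[? x] && H.[? x])) [disjoint domf G & domf H]%fset.
  apply: (iffP (@fdisjointP _ (domf G) (domf H))) => GH x; rewrite ?fndSome.
    by apply/negP => /andP[/GH/negP].
  by move=> xG; have := GH x; rewrite !fndSome xG.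
elim: Gs => [|G Gs IH] /=; first by apply: (iffP idP).
have allGP : reflect
    (forall x, all (fun H : context atom => ~~ (G.[? x] && H.[? x])) Gs)
    (all (fun H : context atom => [disjoint domf G & domf H]%fset) Gs).
  elim: Gs {IH} => [|H Gs IH] /=; first by apply: (iffP idP).
  apply: (iffP andP) => [[/disjP GH /IH Hs] x|Hx]; first by rewrite GH Hs.
  by split; [apply/disjP => x | apply/IH => x]; have /andP[] := Hx x.
apply: (iffP andP) => [[/allGP GH /IH Hs] x|Hx]; first by rewrite GH Hs.
by split; [apply/allGP => x | apply/IH => x]; have /andP[] := Hx x.
Qed.

Lemma fnd_catE (atom : Type) (G H : context atom) x :
  (G + H).[? x] = if H.[? x] is Some A then Some A else G.[? x].
Proof. by rewrite fnd_cat; case: fndP. Qed.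

Lemma fnd_decl (atom : Type) x y (A : type atom) :
  (decl x A).[? y] = if y == x then Some A else None.
Proof. by rewrite fnd_set fnd_fmap0. Qed.

Lemma fnd_emp (atom : Type) x : (emp : context atom).[? x] = None.
Proof. exact: fnd_fmap0. Qed.

Definition zones (atom : Type) (u o s : option (type atom)) : entry atom :=
  match u, o, s with
  | Some A, _, _ => Some (unrestricted, A)
  | _, Some A, _ => Some (irrelevant, A)
  | _, _, Some A => Some (strict, A)
  | _, _, _ => None
  end.

Definition env_of (atom : Type) (G O D : context atom) : env atom :=
  fun i => if i is inl x then zones G.[? x] O.[? x] D.[? x] else None.

Definition fndE := (fnd_catE, fnd_decl, fnd_emp).

Lemma typing_lc (atom : Type) (const : choiceType) (Sg : signature atom const)
    G O D M A :
  typing Sg G O D M A -> lc 0 M.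
Proof.
elim=> {G O D M A} //= [G O D x A M B|G O D x A M B|G O D x A M B
  |G O D M N A B|G O D M N A B|G O DM DN M N A B] _ _.
- exact: lc_close.
- exact: lc_close.
- exact: lc_close.
- by move=> -> _ ->.
- by move=> -> _ ->.
- by move=> -> _ ->.
Qed.

Lemma typing_disjoint (atom : Type) (const : choiceType)
    (Sg : signature atom const) G O D M A :
  typing Sg G O D M A -> disjoint_contexts [:: G; O; D].
Proof.
case=> {G O D M A} [G O c A|G O x A|G O x A
  |G O D x A M B|G O D x A M B|G O D x A M B
  |G O D M N A B|G O D M N A B|G O DM DN M N A B] /disjoint_contextsP dj *;
  apply/disjoint_contextsP => y; move: (dj y) => /=; rewrite ?fndE.
- by rewrite !andbF !andbT.
- by case: eqP; case: (G.[? y]); case: (O.[? y]).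
- by case: eqP; case: (G.[? y]); case: (O.[? y]).
- by case: eqP; case: (G.[? y]); case: (O.[? y]); case: (D.[? y]).
- by case: eqP; case: (G.[? y]); case: (O.[? y]); case: (D.[? y]).
- by case: eqP; case: (G.[? y]); case: (O.[? y]); case: (D.[? y]).
- by [].
- by [].
- by case: (DM.[? y]); case: (DN.[? y]); case: (G.[? y]); case: (O.[? y]).
Qed.

Lemma typing_wt (atom : Type) (const : choiceType) (Sg : signature atom const)
    G O D M A :
  typing Sg G O D M A -> wt Sg (env_of G O D) M A.
Proof.
elim=> {G O D M A} [G O c A|G O x A|G O x A
  |G O D x A M B|G O D x A M B|G O D x A M B
  |G O D M N A B|G O D M N A B|G O DM DN M N A B] /disjoint_contextsP dj.
- move=> Hc; split=> // -[x|//] /=; rewrite fndE.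
  by case: (G.[? x]) => [?|] //; case: (O.[? x]).
- split=> [|[y|//] yx] /=.
    by exists unrestricted; rewrite //= !fndE eqxx.
  by rewrite !fndE; case: eqP => // _; case: (G.[? y]) => [?|]; case: (O.[? y]).
- split=> [|[y|//] yx] /=.
    exists strict => //=; move: (dj x) => /=; rewrite !fndE eqxx.
    by case: (G.[? x]); case: (O.[? x]).
  rewrite fndE; case: (y =P x) => [E|_]; first by rewrite E in yx.
  by case: (G.[? y]) => [?|] //; case: (O.[? y]).
(* By disjointness no zone declares [x], so [wt_close] may turn it into index 0. *)
- move=> Ht H; exists B => //; apply: wt_close (typing_lc Ht) H.
    move: (dj x) => /=; rewrite !fndE eqxx.
    by case: (G.[? x]); case: (O.[? x]); case: (D.[? x]).
  move=> [y|j] //=; rewrite /update (inj_eq inl_inj) /= !fndE.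
  by case: eqP.
- move=> Ht H; exists B => //; apply: wt_close (typing_lc Ht) H.
    move: (dj x) => /=; rewrite !fndE eqxx.
    by case: (G.[? x]); case: (O.[? x]); case: (D.[? x]).
  move=> [y|j] //=; rewrite /update (inj_eq inl_inj) /= !fndE.
  case: eqP => // ->; move: (dj x) => /=; rewrite !fndE eqxx.
  by case: (G.[? x]); case: (O.[? x]); case: (D.[? x]).
- move=> Ht H; exists B => //; apply: wt_close (typing_lc Ht) H.
    move: (dj x) => /=; rewrite !fndE eqxx.
    by case: (G.[? x]); case: (O.[? x]); case: (D.[? x]).
  move=> [y|j] //=; rewrite /update (inj_eq inl_inj) /= !fndE.
  case: eqP => // ->; move: (dj x) => /=; rewrite !fndE eqxx.
  by case: (G.[? x]); case: (O.[? x]); case: (D.[? x]).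
- move=> _ HM _ HN; exists (env_of G O D), (env_of (G + D) O emp), A; split=> //.
  case=> [x|//] /=; move: (dj x) => /=; rewrite !fndE.
  by case: (G.[? x]) => [?|]; case: (O.[? x]) => [?|]; case: (D.[? x]).
- move=> _ HM _ HN.
  exists (env_of G O D), (env_of (G + O + D) emp emp), A; split=> //.
  case=> [x|//] /=; move: (dj x) => /=; rewrite !fndE.
  by case: (G.[? x]) => [?|]; case: (O.[? x]) => [?|]; case: (D.[? x]).
- move=> _ HM _ HN.
  exists (env_of (G + DN) O DM), (env_of (G + DM) O DN), A; split=> //.
  case=> [x|//] /=; move: (dj x) => /=; rewrite !fndE.
  by case: (G.[? x]) => [?|]; case: (O.[? x]) => [?|]; case: (DM.[? x]) => [?|];
    case: (DN.[? x]).
Qed.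

Lemma context_bound (atom : Type) (G : context atom) :
  exists n, forall x, n <= x -> G.[? x] = None.
Proof.
exists (\max_(x <- domf G) x).+1 => x lex; apply/not_fnd/negP => xG.
by move: lex; rewrite ltnNge => /negP; apply; apply: leq_bigmax_seq.
Qed.

Lemma bounded_env_of (atom : Type) (G O D : context atom) : bounded (env_of G O D).
Proof.
have [[a Ha] [b Hb] [c Hc]] :=
  And3 (context_bound G) (context_bound O) (context_bound D).
exists (maxn a (maxn b c)) => x; rewrite !geq_max => /and3P[ax bx cx] /=.
by rewrite Ha // Hb // Hc.
Qed.

Fixpoint expr_size (atom const : Type) (M : expr atom const) : nat :=
  match M with
  | Cst _ | Var _ | BVar _ => 1
  | Lam _ _ M1 => (expr_size M1).+1
  | App M1 _ M2 => (maxn (expr_size M1) (expr_size M2)).+1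
  end.

Lemma expr_size_rename (atom const : Type) f (M : expr atom const) :
  expr_size (rename f M) = expr_size M.
Proof.
elim: M f => //= [x|j|k A M IH|M1 IH1 k M2 IH2] f; rewrite ?IH ?IH1 ?IH2 //.
  by case: f.
by case: f.
Qed.

Lemma lc_open (atom const : Type) n f y (M : expr atom const) :
  lc n.+1 M -> f (inr n) = inl y ->
  (forall x, f (inl x) = inl x) -> (forall j, j < n -> f (inr j) = inr j) ->
  lc n (rename f M).
Proof.
elim: M n f => [c|x|j|k A M IH|M1 IH1 k M2 IH2] n f //= HM fn fx fj.
- by rewrite fx.
- move: HM; rewrite ltnS leq_eqVlt => /predU1P[->|jn]; first by rewrite fn.
  by rewrite fj.
- apply: IH => // [|x|[|j]] //; rewrite /lift /= ?fn ?fx //.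
  by rewrite ltnS => /fj->.
- by case/andP: HM => ? ?; rewrite IH1 // IH2.
Qed.

(** The induction is on size because a body opened at a fresh name is not a subterm. Environments
    agree pointwise, which avoids functional extensionality. *)
Lemma wt_typing (atom : Type) (const : choiceType) (Sg : signature atom const)
    (e : env atom) G O D M B :
  disjoint_contexts [:: G; O; D] -> (forall i, e i = env_of G O D i) ->
  lc 0 M -> wt Sg e M B -> typing Sg G O D M B.
Proof.
elim: {M}(expr_size M) {-2}M (leqnn (expr_size M)) e G O D B => [|n IH].
  by case.
case=> [c|x|j|k A M|M1 k M2] sM e G O D B djb He; rewrite /= in sM *;
  have /disjoint_contextsP dj := djb.
- move=> _ [He0 Hc].
  have D0 : D = emp.
    apply/fmapP => x; move: (He0 (inl x)) (dj x); rewrite He /= fndE.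
    by case: (G.[? x]); case: (O.[? x]); case: (D.[? x]).
  rewrite D0; apply: typing_cst => //; apply/disjoint_contextsP => x /=.
  by have /= /and3P[/and3P[-> _ _] _ _] := dj x.
- move=> _ [[l ex Hl] He0].
  move: ex; rewrite He /=.
  case EG: (G.[? x]) => [A|].
    move=> [_ <-].
    have D0 : D = emp.
      apply/fmapP => y; rewrite fndE; move: (dj y) => /=.
      case: (y =P x) => [->|yx]; first by rewrite EG; case: (D.[? x]); case: (O.[? x]).
      have {}yx : inl y <> inl x :> index by case.
      move: (He0 _ yx); rewrite He /=.
      by case: (G.[? y]); case: (O.[? y]); case: (D.[? y]).
    have -> : G = G.[~ x] + decl x A.
      by apply/fmapP => y; rewrite fndE fnd_rem1 fnd_decl; case: eqP => [->|].
    rewrite D0; apply: typing_var_u; apply/disjoint_contextsP => y /=.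
    move: (dj y) => /=; rewrite fnd_rem1 fnd_decl; case: eqP => [->|] /=.
      by rewrite EG; case: (O.[? x]).
    by case: (G.[? y]); case: (O.[? y]).
  case: (O.[? x]) => [A [El]|]; first by rewrite -El in Hl.
  case ED: (D.[? x]) => [A|] // [_ <-].
  have -> : D = decl x A.
    apply/fmapP => y; rewrite fndE; case: (y =P x) => [->|yx] //.
    have {}yx : inl y <> inl x :> index by case.
    move: (He0 _ yx) (dj y); rewrite He /=.
    by case: (G.[? y]); case: (O.[? y]); case: (D.[? y]).
  apply: typing_var_1; apply/disjoint_contextsP => y /=.
  move: (dj y) => /=; rewrite fnd_decl; case: eqP => [->|] /=; first by rewrite ED.
  by case: (G.[? y]); case: (O.[? y]).
- by [].
- move=> HM [B1 -> H].
  have [m Hm] := fresh_bound M; have [p Hp] := bounded_env_of G O D.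
  pose y := maxn m p.
  have Hy : fresh y M by apply/Hm/leq_maxl.
  have ey : env_of G O D (inl y) = None by apply/Hp/leq_maxr.
  have {}H := wt_open (etrans (He _) ey) H.
  have HM' : lc 0 (rename (open_index y) M) by apply: lc_open HM _ _ _.
  have sM' : expr_size (rename (open_index y) M) <= n by rewrite expr_size_rename.
  have <- : abs y k A (rename (open_index y) M) = Lam k A M.
    by rewrite /abs close_renameK.
  have [Gy Oy Dy] : [/\ G.[? y] = None, O.[? y] = None & D.[? y] = None].
    by move: ey => /=; case: (G.[? y]); case: (O.[? y]); case: (D.[? y]).
  case: k H => H.
  + apply: typing_abs_1.
      apply/disjoint_contextsP => x; move: (dj x) => /=; rewrite !fndE.
      by case: eqP => [->|_]; rewrite ?Gy ?Oy ?Dy //= !andbF !andbT.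
    apply: IH sM' _ _ _ _ _ _ _ HM' H.
      apply/disjoint_contextsP => x; move: (dj x) => /=; rewrite !fndE.
      by case: eqP => [->|_] //; rewrite Gy Oy.
    case=> [x|j]; rewrite /update ?He // (inj_eq inl_inj) /= !fndE.
    by case: eqP => [->|_] //; rewrite Gy Oy.
  + apply: typing_abs_0.
      apply/disjoint_contextsP => x; move: (dj x) => /=; rewrite !fndE.
      by case: eqP => [->|_]; rewrite ?Gy ?Oy ?Dy //= !andbF !andbT.
    apply: IH sM' _ _ _ _ _ _ _ HM' H.
      apply/disjoint_contextsP => x; move: (dj x) => /=; rewrite !fndE.
      by case: eqP => [->|_] //; rewrite Gy Dy.
    case=> [x|j]; rewrite /update ?He // (inj_eq inl_inj) /= !fndE.
    by case: eqP => [->|_] //; rewrite Gy.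
  + apply: typing_abs_u.
      apply/disjoint_contextsP => x; move: (dj x) => /=; rewrite !fndE.
      by case: eqP => [->|_]; rewrite ?Gy ?Oy ?Dy //= !andbF !andbT.
    apply: IH sM' _ _ _ _ _ _ _ HM' H.
      apply/disjoint_contextsP => x; move: (dj x) => /=; rewrite !fndE.
      by case: eqP => [->|_] //; rewrite Oy Dy.
    case=> [x|j]; rewrite /update ?He // (inj_eq inl_inj) /= !fndE.
    by case: eqP => [->|_] //.
- move=> /andP[HM1 HM2] [e1 [e2 [A [Hs H1 H2]]]].
  move: sM; rewrite ltnS geq_max => /andP[s1 s2].
  have Hr j : e1 (inr j) = None /\ e2 (inr j) = None.
    by move: (Hs (inr j)); rewrite He /=; case: (e1 _); case: (e2 _).
  case: k Hs H1 => Hs H1.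
  (* The splitting determines the partition of the strict zone: a declaration of [D] is strict in
     exactly one of [e1] and [e2]. *)
  + pose P x := if e1 (inl x) is Some (strict, _) then true else false.
    pose DM := filterf D P; pose DN := filterf D (predC P).
    have -> : D = DM + DN.
      apply/fmapP => x; rewrite !fndE !fnd_filterf /=; case: (P x) => //=.
      by case: (D.[? x]).
    apply: typing_app_1.
    * apply/disjoint_contextsP => x; move: (dj x) => /=.
      by rewrite !fnd_filterf /=; case: (P x); case: (G.[? x]); case: (O.[? x]);
        case: (D.[? x]).
    * apply: IH s1 _ _ _ _ _ _ _ HM1 H1.
        apply/disjoint_contextsP => x; move: (dj x) => /=.
        by rewrite !fndE !fnd_filterf /=; case: (P x); case: (G.[? x]);
          case: (O.[? x]); case: (D.[? x]).
      case=> [x|j]; last by case: (Hr j).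
      move: (Hs (inl x)) (dj x); rewrite He /= !fndE !fnd_filterf /= /P.
      case: (G.[? x]) => [?|]; case: (O.[? x]) => [?|]; case: (D.[? x]) => [?|] //;
        by case: (e1 _) => [[[] ?]|]; case: (e2 _) => [[[] ?]|] //= [] // _ -> _.
    * apply: IH s2 _ _ _ _ _ _ _ HM2 H2.
        apply/disjoint_contextsP => x; move: (dj x) => /=.
        by rewrite !fndE !fnd_filterf /=; case: (P x); case: (G.[? x]);
          case: (O.[? x]); case: (D.[? x]).
      case=> [x|j]; last by case: (Hr j).
      move: (Hs (inl x)) (dj x); rewrite He /= !fndE !fnd_filterf /= /P.
      case: (G.[? x]) => [?|]; case: (O.[? x]) => [?|]; case: (D.[? x]) => [?|] //;
        by case: (e1 _) => [[[] ?]|]; case: (e2 _) => [[[] ?]|] //= [] // _ _ ->.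
  + apply: (typing_app_0 (A := A) djb).
      apply: IH s1 _ _ _ _ _ djb _ HM1 H1.
      case=> [x|j]; last by case: (Hr j).
      move: (Hs (inl x)); rewrite He /=; case: (zones _ _ _) => [[l ?]|];
        case: (e1 _) => [[l1 ?]|] //; case: (e2 _) => [[l2 ?]|] //= [+ -> _].
      by case: l; case: l1; case: l2.
    apply: IH s2 _ _ _ _ _ _ _ HM2 H2.
      by apply/disjoint_contextsP => x /=; rewrite !fnd_emp !andbF.
    case=> [x|j]; last by case: (Hr j).
    move: (Hs (inl x)) (dj x); rewrite He /= !fndE.
    case: (G.[? x]) => [?|]; case: (O.[? x]) => [?|]; case: (D.[? x]) => [?|] //;
      by case: (e1 _) => [[[] ?]|]; case: (e2 _) => [[[] ?]|] //= [] // _ _ ->.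
  + apply: (typing_app_u (A := A) djb).
      apply: IH s1 _ _ _ _ _ djb _ HM1 H1.
      case=> [x|j]; last by case: (Hr j).
      move: (Hs (inl x)); rewrite He /=; case: (zones _ _ _) => [[l ?]|];
        case: (e1 _) => [[l1 ?]|] //; case: (e2 _) => [[l2 ?]|] //= [+ -> _].
      by case: l; case: l1; case: l2.
    apply: IH s2 _ _ _ _ _ _ _ HM2 H2.
      apply/disjoint_contextsP => x; move: (dj x) => /=; rewrite !fndE.
      by case: (G.[? x]); case: (O.[? x]); case: (D.[? x]).
    case=> [x|j]; last by case: (Hr j).
    move: (Hs (inl x)) (dj x); rewrite He /= !fndE.
    case: (G.[? x]) => [?|]; case: (O.[? x]) => [?|]; case: (D.[? x]) => [?|] //;
      by case: (e1 _) => [[[] ?]|]; case: (e2 _) => [[[] ?]|] //= [] // _ _ ->.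
Qed.

Theorem theorem3p5 (atom : Type) (const : choiceType) (Sg : signature atom const)
  (G O D : context atom) (M M' : expr atom const) (A : type atom) :
  typing Sg G O D M A -> beta M M' -> typing Sg G O D M' A.
Proof.
move=> HM Hb; have /andP[_ HM'] := beta_lc Hb.
apply: (wt_typing (e := env_of G O D)) => //; first exact: typing_disjoint HM.
exact: wt_beta Hb (bounded_env_of _ _ _) (typing_wt HM).
Qed.
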